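(* Let $G$ be a finite nilpotent group. Then $|\mathcal{D}(G)|=5$ if and only if, for some prime $p$, one of the following holds: (i) $|G/Z(G)|=p^3$ and $G$ has an abelian maximal subgroup; (ii) $|G/Z(G)|=p^4$ and $G$ has exactly two conjugacy class sizes, namely $1$ and $p^m$, for some fixed $m\in\{1,2,3\}$. Moreover, in case (i) $$\mathcal{D}(G)=\left\{1,\ \frac{2p-1}{p^2},\ \frac{p^2+p-1}{p^3},\ \frac{3p-2}{p^3},\ \frac{2p^2-1}{p^4}\right\},$$ and in case (ii) $$\mathcal{D}(G)=\left\{1,\ \frac{p^m+p-1}{p^{m+1}},\ \frac{p^m+p^2-1}{p^{m+2}},\ \frac{p^m+p^3-1}{p^{m+3}},\ \frac{p^m+p^4-1}{p^{m+4}}\right\}.$$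
   Context: For a finite group $G$ and a subgroup $H\leq G$, the relative commutativity degree of $H$ in $G$ is $$d(H,G)=\frac{\#\{(h,g)\in H\times G : hg=gh\}}{|H||G|},$$ and $\mathcal{D}(G)=\{d(H,G) : H\leq G\}$ is the set of all relative commutativity degrees of subgroups of $G$. $Z(G)$ denotes the center of $G$. *)

(* Defs.v *)
From mathcomp Require Import all_boot all_order all_algebra all_fingroup.
From mathcomp Require Import all_solvable.
From mathcomp Require Import finmap.

Set Implicit Arguments.
Unset Strict Implicit.
Unset Printing Implicit Defensive.

Import GRing.Theory.

Local Open Scope ring_scope.

Definition comm_pairs (gT : finGroupType) (H G : {set gT}) : {set gT * gT} :=
  [set hg : gT * gT in setX H G | (hg.1 * hg.2 == hg.2 * hg.1)%g].

Definition rel_comm_deg (gT : finGroupType) (H G : {set gT}) : rat :=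
  #|comm_pairs H G|%:R / (#|H| * #|G|)%:R.

Definition rel_comm_degs (gT : finGroupType) (G : {group gT}) : {fset rat} :=
  [fset rel_comm_deg (H : {group gT}) G | H in subgroups G]%fset.

Definition class_sizes (gT : finGroupType) (G : {group gT}) : {fset nat} :=
  [fset #|pred_of_set xG| | xG in classes G]%fset.

Definition abelian_max_quo_p3 (gT : finGroupType) (G : {group gT}) (p : nat) : Prop :=
  #|(G / 'Z(G))%g| = (p ^ 3)%N /\
  exists M : {group gT}, maximal M G /\ abelian M.

Definition two_class_sizes_quo_p4 (gT : finGroupType) (G : {group gT}) (p m : nat) : Prop :=
  [/\ #|(G / 'Z(G))%g| = (p ^ 4)%N,
      m \in [:: 1; 2; 3]%N
    & class_sizes G = [fset 1%N; (p ^ m)%N]%fset].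

(* Main.v *)
Require Import Defs.
From mathcomp Require Import all_boot all_order all_algebra all_fingroup.
From mathcomp Require Import all_solvable.
From mathcomp Require Import finmap.
From mathcomp Require Import ring zify.

(** Write d(H) for d(H, G), Z for the centre of G and D for the set of degrees.
    Averaging over either factor gives
      d(H) = (1/|G|) \sum_(g in G) 1/|g ^: H| = (1/|H|) \sum_(h in H) 1/|h ^: G|.
    The first formula shows that d decreases when H grows and that
    d(HZ) = d(H), so only subgroups containing Z matter; the second one computes
    d(H) from the sizes of the G-classes that meet H.

    The first formula also shows when the decrease is strict
    ([rel_comm_deg_lt]): if 'C_K[g] <= H < K for some g in G, then
    d(K) < d(H). Hence every subgroup K not contained in Z has a maximal
    subgroup of larger degree. If L is a centraliser, hence equal to its own
    double centraliser, then any K properly above L fails to commute with some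
    g in 'C_G(L), and the maximal subgroup can be chosen above L; as G is
    nilpotent its index is prime. So between L and K there are at least as many
    degrees as |K : L| has prime factors, counted with multiplicity
    ([closed_chain]). With L = Z and K = G this bounds the number of prime
    factors of |G : Z| by |D| - 1. When the bound is attained, the chains
    through any centraliser L leave no room for other degrees: the degrees in
    [d(L), 1[ are exactly as many as the prime factors of |L : Z|
    ([closed_count_eq]), and centralisers with equally many prime factors over
    Z have equal degrees ([closed_deg_eq]).

    Let |D| = 5, so |G : Z| has at most four prime factors.

    |G : Z| is a power of a prime p ([five_degs_center_index]). Otherwise G is a
    direct product A x B of two nonabelian groups of coprime orders, |G : Z| has
    exactly four prime factors, and 'C_G(A) and 'C_G(B) have two each. Then
    d(A) = d(B); but the denominators of d(A) and d(B) are coprime, so both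
    would be integers strictly between 0 and 1.

    If all noncentral classes have the same size c, then d(H) depends only on
    |H : Z| = p^k, and D has one element for each k. For |G : Z| = p^n with
    n <= 3 this leaves too few degrees, so n = 3 and some noncentral x has a
    centraliser of index p; that centraliser is abelian and maximal
    ([five_degs_index_le3]).

    For |G : Z| = p^4 all noncentral classes have the same size
    ([five_degs_uniform]). Let p^e be the largest class size, attained at y, and
    L = 'C_G[y], so that [d(L), 1[ contains 4 - e degrees. If smaller classes
    occur, one of them comes from some x of order p modulo Z. If e = 3, then
    d(L) and d(<x>Z) are two degrees where only one fits. If e = 2, three
    degrees turn up where only two fit: d(L), d(<x>Z), and the degree of a
    subgroup with all noncentral classes of size p and index p^2 over Z, which
    is also that of a subgroup with classes of size p^2 and index p over Z. One
    of these two subgroups always exists, because G / Z contains an elementary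
    abelian group of order p^2 ([exists_elementary_p2]).

    Conversely the degrees are computed directly: in case (ii) the class sizes
    are uniform, and in case (i) the noncentral elements of the abelian maximal
    subgroup M have classes of size p and those outside M have classes of size
    p^2. *)

Set Implicit Arguments.
Unset Strict Implicit.
Unset Printing Implicit Defensive.

Import Order.TTheory GRing.Theory Num.Theory.

Local Open Scope ring_scope.


(** * Degrees of subgroups whose noncentral classes have equal size *)

(** The degree of a subgroup H of index b over the centre whose noncentral
    elements all have classes of size c, namely (1 + (b - 1)/c)/b. In this form
    the symmetry between c and b is visible; it makes classes of size p^2 with
    index p give the same degree as classes of size p with index p^2. *)
Definition uniform_deg (c b : nat) : rat :=
  1 - (1 - c%:R^-1) * (1 - b%:R^-1).

Lemma uniform_degC c b : uniform_deg c b = uniform_deg b c.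
Proof. by rewrite /uniform_deg [X in 1 - X]mulrC. Qed.

Lemma uniform_deg_anti c b b' : (1 < c)%N -> (0 < b < b')%N ->
  uniform_deg c b' < uniform_deg c b.
Proof.
move=> c1 /andP[b0 ltb]; rewrite ltrD2l ltrN2 ltr_pM2l ?ltrD2l ?ltrN2.
  by rewrite ltf_pV2 ?posrE ?ltr0n ?ltr_nat // (ltn_trans b0).
by rewrite subr_gt0 invf_lt1 ?ltr1n ?ltr0n // ltnW.
Qed.

Lemma uniform_deg1 c : uniform_deg c 1 = 1.
Proof. by rewrite /uniform_deg invr1 subrr mulr0 subr0. Qed.

Lemma uniform_degE c b : (0 < c)%N -> (0 < b)%N ->
  uniform_deg c b = (c%:R + b%:R - 1) / (c * b)%:R.
Proof.
move=> c0 b0; rewrite /uniform_deg natrM.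
have ? : c%:R != 0 :> rat by rewrite pnatr_eq0 -lt0n.
have ? : b%:R != 0 :> rat by rewrite pnatr_eq0 -lt0n.
by field; apply/andP.
Qed.

(** * The two averaging formulas *)

Section RelCommDeg.
Variable gT : finGroupType.
Implicit Types G H K L : {group gT}.

Lemma card_comm_pairsl H G :
  #|comm_pairs H G| = (\sum_(h in H) #|'C_G[h]%g|)%N.
Proof.
rewrite /comm_pairs -sum1_card.
under [RHS]eq_bigr do rewrite -sum1_card.
rewrite pair_big_dep; apply: eq_bigl => -[h g]; rewrite inE in_setX in_setI /= andbA.
by congr (_ && _); apply/eqP/cent1P.
Qed.

Lemma card_comm_pairsr H G :
  #|comm_pairs H G| = (\sum_(g in G) #|'C_H[g]%g|)%N.
Proof.
rewrite card_comm_pairsl.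
under eq_bigr do rewrite -sum1_card.
under [RHS]eq_bigr do rewrite -sum1_card.
rewrite !pair_big_dep (reindex (fun x : gT * gT => (x.2, x.1))) /=; last first.
  by exists (fun x : gT * gT => (x.2, x.1)) => -[].
by apply: eq_bigl => -[g h] /=; rewrite !in_setI cent1C andbA [RHS]andbA
  [(g \in G) && _]andbC.
Qed.

Lemma card_class_gt0 G x : (0 < #|(x ^: G)%g|)%N.
Proof. by rewrite card_gt0; apply/set0Pn; exists x; apply: class_refl. Qed.

Lemma card_cent1_class G x :
  #|'C_G[x]%g|%:R = #|G|%:R / #|(x ^: G)%g|%:R :> rat.
Proof.
have n0: #|(x ^: G)%g|%:R != 0 :> rat.
  by rewrite pnatr_eq0 -lt0n card_class_gt0.
apply: (mulIf n0); rewrite mulfVK // -natrM -index_cent1 Lagrange //.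
exact: subsetIl.
Qed.

Lemma card_group_neq0 G : #|G|%:R != 0 :> rat.
Proof. by rewrite pnatr_eq0 -lt0n cardG_gt0. Qed.

Lemma rel_comm_degEr H G :
  rel_comm_deg H G = (\sum_(g in G) (#|(g ^: H)%g|%:R)^-1) / #|G|%:R.
Proof.
rewrite /rel_comm_deg card_comm_pairsr natr_sum natrM.
under eq_bigr do rewrite card_cent1_class.
by rewrite -mulr_sumr -mulf_div divff ?card_group_neq0 // mul1r.
Qed.

Lemma rel_comm_degEl H G :
  rel_comm_deg H G = (\sum_(h in H) (#|(h ^: G)%g|%:R)^-1) / #|H|%:R.
Proof.
rewrite /rel_comm_deg card_comm_pairsl natr_sum natrM.
under eq_bigr do rewrite card_cent1_class mulrC.
by rewrite -mulr_suml -mulf_div divff ?card_group_neq0 // mulr1.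
Qed.

Lemma class_inv_gt0 G x : 0 < #|(x ^: G)%g|%:R^-1 :> rat.
Proof. by rewrite invr_gt0 ltr0n card_class_gt0. Qed.

Lemma class_invS H K x : H \subset K ->
  (#|(x ^: K)%g|%:R)^-1 <= (#|(x ^: H)%g|%:R)^-1 :> rat.
Proof.
move=> sHK; rewrite lef_pV2 ?posrE ?ltr0n ?card_class_gt0 //.
by rewrite ler_nat subset_leq_card ?classS.
Qed.

Lemma rel_comm_deg_le H K G : H \subset K ->
  rel_comm_deg K G <= rel_comm_deg H G.
Proof.
move=> sHK; rewrite !rel_comm_degEr ler_wpM2r ?invr_ge0 ?ler0n //.
by apply: ler_sum => g _; apply: class_invS.
Qed.

(** The hypothesis makes 'C_H[g] and 'C_K[g] equal, so that the class of g under
    K is strictly larger than under H, while every other class under H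
    is contained in the one under K. *)
Lemma rel_comm_deg_lt H K G g : H \proper K -> g \in G ->
  ('C_K[g] \subset H)%g -> rel_comm_deg K G < rel_comm_deg H G.
Proof.
move=> ltHK Gg sCH; have sHK := proper_sub ltHK.
rewrite !rel_comm_degEr ltr_pM2r ?invr_gt0 ?ltr0n ?cardG_gt0 //.
rewrite (bigD1 g) //= [ltRHS](bigD1 g) //= ltr_leD //; last first.
  by apply: ler_sum => x _; apply: class_invS.
rewrite ltf_pV2 ?posrE ?ltr0n ?card_class_gt0 // ltr_nat -!index_cent1.
have ->: ('C_H[g] = 'C_K[g])%g.
  apply/eqP; rewrite eqEsubset setSI //= subsetI sCH.
  by rewrite subsetIr.
by rewrite -!divgS ?subsetIl // ltn_divRL ?divnK ?cardSg ?proper_card ?subsetIl.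
Qed.

Lemma rel_comm_deg_gt0 H G : 0 < rel_comm_deg H G.
Proof.
rewrite rel_comm_degEr divr_gt0 ?ltr0n ?cardG_gt0 //.
rewrite (bigD1 1%g) //= ltr_pwDl ?class_inv_gt0 //.
by apply: sumr_ge0 => x _; apply/ltW/class_inv_gt0.
Qed.

Lemma class_by_center G x : x \in G -> (x ^: 'Z(G))%g = [set x].
Proof.
move=> Gx; apply/setP => y; rewrite inE; apply/imsetP/eqP => [[z Zz ->] | ->].
  by rewrite conjgE (centerC Gx Zz) mulKg.
by exists 1%g; rewrite ?group1 ?conjg1.
Qed.

(** H and H <*> 'Z(G) have the same orbits by conjugation, so the average of
    1/|g ^: H| over G does not change. *)
Lemma rel_comm_deg_joing_center H G : H \subset G ->
  rel_comm_deg (H <*> 'Z(G))%g G = rel_comm_deg H G.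
Proof.
move=> sHG; rewrite !rel_comm_degEr; congr (_ / _); apply: eq_bigr => g Gg /=.
rewrite joingC cent_joinEr ?classM ?class_by_center ?class_support_set1l //.
by rewrite (subset_trans sHG) // centsC subsetIr.
Qed.
End RelCommDeg.

Lemma fset_card_lt (T : choiceType) (A B : {fset T}) x :
  {subset A <= B} -> x \in B -> x \notin A -> (#|` A| < #|` B|)%N.
Proof.
move=> sAB Bx nAx; rewrite -add1n; have := cardfsU1 x A; rewrite nAx => <-.
by apply/fsubset_leq_card/fsubsetP => y; rewrite !inE => /orP[/eqP-> | /sAB].
Qed.

(** * Number of prime factors with multiplicity *)

Section BigOmega.
Local Open Scope nat_scope.

Definition bigomega (m : nat) : nat := \sum_(q < m.+1) logn q m.

Lemma bigomega_widen m n : m <= n -> bigomega m = \sum_(q < n.+1) logn q m.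
Proof.
rewrite -ltnS => lemn; rewrite /bigomega (big_ord_widen _ (fun q => logn q m) lemn).
rewrite [RHS](bigID (fun q : 'I_n.+1 => q < m.+1)) /=.
by rewrite [X in _ = _ + X]big1 ?addn0 // => q; rewrite -leqNgt => /ltn_log0.
Qed.

Lemma bigomegaM m n : 0 < m -> 0 < n ->
  bigomega (m * n) = bigomega m + bigomega n.
Proof.
move=> m0 n0; rewrite (@bigomega_widen m (m * n)) ?leq_pmulr //.
rewrite (@bigomega_widen n (m * n)) ?leq_pmull // -big_split.
by apply: eq_bigr => q _; rewrite lognM.
Qed.

Lemma bigomega1 : bigomega 1 = 0.
Proof. by rewrite /bigomega big1 // => q _; rewrite logn1. Qed.

Lemma bigomega_prime p : prime p -> bigomega p = 1.
Proof.
move=> p_pr; rewrite /bigomega big_ord_recr /= logn_prime // eqxx big1 //.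
by move=> q _; rewrite logn_prime // ltn_eqF.
Qed.

Lemma bigomegaX p n : prime p -> bigomega (p ^ n) = n.
Proof.
move=> p_pr; elim: n => [|n IHn]; first exact: bigomega1.
by rewrite expnS bigomegaM ?expn_gt0 ?prime_gt0 // IHn bigomega_prime.
Qed.

Lemma bigomega_gt0 m : 1 < m -> 0 < bigomega m.
Proof.
move=> m1; rewrite -(divnK (pdiv_dvd m)) bigomegaM ?pdiv_gt0 //.
  by rewrite [bigomega (pdiv m)]bigomega_prime ?pdiv_prime // addn1.
by rewrite divn_gt0 ?pdiv_gt0 // pdiv_leq // ltnW.
Qed.

Lemma bigomega_le1 m : 0 < m -> bigomega m <= 1 -> (m == 1) || prime m.
Proof.
move=> m0; rewrite -(divnK (pdiv_dvd m)); set a := m %/ pdiv m.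
have a0: 0 < a by rewrite divn_gt0 ?pdiv_gt0 // pdiv_leq.
case: (leqP m 1) => [|m1].
  by rewrite leq_eqVlt ltnS leqNgt m0 orbF => /eqP m1; rewrite /a m1.
rewrite bigomegaM ?pdiv_gt0 // [bigomega (pdiv m)]bigomega_prime ?pdiv_prime //.
rewrite addn1 ltnS => a_le; have ->: a = 1.
  apply/eqP; rewrite eqn_leq a0 andbT leqNgt.
  by apply: contraL a_le => /bigomega_gt0; rewrite ltnNge.
by rewrite mul1n pdiv_prime ?orbT.
Qed.
End BigOmega.

(** * Chains of degrees through a centraliser *)

Lemma maximal_nilpotent_normal (gT : finGroupType) (M K : {group gT}) :
  nilpotent K -> maximal M K -> (M <| K)%g.
Proof.
move=> nilK maxM; have prM := maxgroupp maxM.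
rewrite /normal proper_sub //; have /andP[_] := nilpotent_proper_norm nilK prM.
case/maxgroupP: maxM => _ maxM; apply: contraR => nMK.
rewrite (maxM 'N_K(M)%G) ?subsetIl //=; last first.
  by rewrite subsetI proper_sub ?normG.
by rewrite properE subsetIl subsetI subxx.
Qed.

Lemma maximal_nilpotent_prime_index (gT : finGroupType) (M K : {group gT}) :
  nilpotent K -> maximal M K -> prime #|K : M|%g.
Proof.
move=> nilK maxM; have prM := maxgroupp maxM.
apply: index_maxnormal_sol_prime (nilpotent_sol nilK) _.
apply/maxgroupP; split=> [|H /andP[prH _] sMH].
  by rewrite prM normal_norm ?maximal_nilpotent_normal.
by case/maxgroupP: maxM => _; apply.
Qed.

Section Chains.
Variables (gT : finGroupType) (G : {group gT}).
Implicit Types H K L : {group gT}.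

Local Notation D := (rel_comm_degs G).
Local Notation d H := (rel_comm_deg H G).

Lemma rel_comm_degsP v :
  reflect (exists2 H : {group gT}, H \subset G & v = d H) (v \in D).
Proof.
apply: (iffP (imfsetP _ _ _ _)) => [[H /= sHG ->] | [H sHG ->]].
  by exists H => //; move: sHG; rewrite inE.
by exists H; rewrite //= inE.
Qed.

Lemma mem_rel_comm_degs H : H \subset G -> d H \in D.
Proof. by move=> sHG; apply/rel_comm_degsP; exists H. Qed.

(** The hypothesis on L says that L is the centraliser of a subset of G. It
    ensures that 'C_G(K) is strictly smaller than 'C_G(L) as long as K is
    strictly larger than L; an element g of the difference gives a maximal
    subgroup M of K that contains 'C_K[g], hence L, and d(K) < d(M). Repeating
    this down to L yields one new degree for each prime factor of |K : L|. *)
Lemma closed_chain L K : nilpotent G -> L \subset K -> K \subset G ->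
    ('C_G('C_G(L)) = L)%g ->
  (bigomega #|K : L|%g <= #|` [fset v in D | (d K <= v < d L)%R]%fset |)%N.
Proof.
move=> nilG + + clL; have [n] := ubnP #|K|; elim: n K => // n IHn K.
rewrite ltnS => leKn sLK sKG.
have [sKL | nsKL] := boolP (K \subset L).
  have ->: #|K : L|%g = 1%N by apply/eqP; rewrite indexg_eq1.
  by rewrite bigomega1.
have /subsetPn[g]: ~~ ('C_G(L) \subset 'C(K))%g.
  apply: contra nsKL => sCC; rewrite -clL subsetI sKG.
  by rewrite centsC.
rewrite inE => /andP[Gg cLg] ncKg.
have := maximal_exists (subsetIl K 'C[g]%G).
case=> [eqC | [M maxM sCM]].
  case/negP: ncKg; rewrite -sub_cent1 -eqC; exact: subsetIr.
have prM := maxgroupp maxM; have sMK := proper_sub prM.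
have sLM: L \subset M.
  apply: subset_trans sCM; rewrite subsetI sLK sub_cent1.
  exact: cLg.
have ltKM := rel_comm_deg_lt prM Gg sCM.
have sMG := subset_trans sMK sKG.
rewrite -(Lagrange_index sMK sLM) bigomegaM ?indexg_gt0 //.
rewrite [bigomega _]bigomega_prime; last first.
  exact: maximal_nilpotent_prime_index (nilpotentS sKG nilG) maxM.
apply: (@leq_ltn_trans _ _ _ (IHn M _ sLM sMG)).
  by rewrite (leq_trans (proper_card prM)).
apply: (fset_card_lt (x := d K)) => [v||].
- rewrite !inE /= => /and3P[-> leMv ->]; rewrite andbT.
  exact: ltW (lt_le_trans ltKM leMv).
- rewrite !inE /= lexx mem_rel_comm_degs //=.
  exact: lt_le_trans ltKM (rel_comm_deg_le _ sLM).
by rewrite !inE /= [_ <= d K]leNgt ltKM andbF.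
Qed.

Lemma closed_cent (A : {set gT}) : A \subset G ->
  ('C_G('C_G('C_G(A))) = 'C_G(A))%g.
Proof.
move=> sAG; apply/eqP; rewrite eqEsubset; apply/andP; split.
  by rewrite setIS // centS // subsetI sAG centsC subsetIr.
by rewrite subsetI subsetIl centsC subsetIr.
Qed.

Lemma closed_center : ('C_G('C_G('Z(G))) = 'Z(G))%g.
Proof. exact: closed_cent. Qed.

Lemma rel_comm_deg_center : d 'Z(G)%G = 1.
Proof.
rewrite rel_comm_degEr (eq_bigr (fun _ => 1)) => [|g Gg].
  by rewrite sumr_const divff ?card_group_neq0.
by rewrite class_by_center // cards1 invr1.
Qed.

Lemma rel_comm_deg_le1 H : H \subset G -> d H <= 1.
Proof.
move=> sHG; rewrite -rel_comm_deg_center -(rel_comm_deg_joing_center sHG).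
exact/rel_comm_deg_le/joing_subr.
Qed.

Lemma rel_comm_deg_lt1 H : H \subset G -> ~~ (H \subset 'Z(G)%g) -> d H < 1.
Proof.
move=> sHG; rewrite subsetI sHG centsC => /subsetPn[g Gg ncg].
have prC : ('C_H[g])%G \proper H.
  by rewrite properE subsetIl subsetI subxx sub_cent1.
apply: lt_le_trans (rel_comm_deg_lt prC Gg (subxx _)) (rel_comm_deg_le1 _).
exact: subset_trans (subsetIl _ _) sHG.
Qed.

Lemma closed_center_sub L : ('C_G('C_G(L)) = L)%g -> 'Z(G)%g \subset L.
Proof.
by move=> <-; rewrite subsetI subsetIl centsC (subset_trans (subsetIl _ _)) //
  centsC subsetIr.
Qed.

(** The chain from L up to G gives bigomega #|G : L| degrees below d(L), and 1 is
    a further degree. *)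
Lemma closed_count L : nilpotent G -> ('C_G('C_G(L)) = L)%g ->
  (#|` [fset v in D | (d L <= v < 1)%R]%fset| + bigomega #|G : L|%g < #|` D|)%N.
Proof.
move=> nilG clL; have sLG: L \subset G by rewrite -clL subsetIl.
rewrite addnC -addnS.
have chain := closed_chain nilG sLG (subxx G) clL.
apply: (leq_trans (leq_add chain (leqnn _))).
set A := [fset v in D | (d L <= v < 1)%R]%fset.
set B := [fset v in D | (_ <= v < d L)%R]%fset.
have n1A: 1 \notin A by rewrite !inE ltxx !andbF.
have dis: [disjoint B & 1 |` A]%fset.
  apply/fdisjointP => v Bv; have ltvL: v < d L by move: Bv; rewrite !inE /= => /and3P[].
  rewrite in_fset1U; apply/norP; split; last first.
    by rewrite !inE /= [_ <= v]leNgt ltvL andbF.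
  by apply: contraTneq ltvL => ->; rewrite -leNgt rel_comm_deg_le1.
have <-: #|` 1 |` A|%fset = (#|` A|.+1)%fset by rewrite cardfsU1 n1A.
rewrite -cardfsUI (_ : B `&` _ = fset0)%fset ?cardfs0 ?addn0; last exact/eqP.
apply: fsubset_leq_card; apply/fsubsetP => v; rewrite in_fsetU in_fset1U.
case/or3P=> [| /eqP-> |]; try by rewrite !inE /= => /and3P[].
by rewrite -rel_comm_deg_center mem_rel_comm_degs ?subsetIl.
Qed.

Lemma bigomega_lt_degs : nilpotent G -> (bigomega #|G : 'Z(G)|%g < #|` D|)%N.
Proof.
by move=> nilG; apply: leq_ltn_trans (closed_count nilG closed_center); apply: leq_addl.
Qed.

(** With as few degrees as the chains allow, the lower bound obtained from the
    chain between the centre and L and the upper bound [closed_count] agree. *)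
Lemma closed_count_eq L : nilpotent G -> ('C_G('C_G(L)) = L)%g ->
    #|` D| = (bigomega #|G : 'Z(G)|%g).+1 ->
  #|` [fset v in D | (d L <= v < 1)%R]%fset| = bigomega #|L : 'Z(G)|%g.
Proof.
move=> nilG clL eqD; have sLG: L \subset G by rewrite -clL subsetIl.
have sZL := closed_center_sub clL.
apply/eqP; rewrite eqn_leq; apply/andP; split; last first.
  have := closed_chain nilG sZL sLG closed_center.
  by rewrite rel_comm_deg_center.
have := closed_count nilG clL.
rewrite eqD ltnS -(Lagrange_index sLG sZL) bigomegaM ?indexg_gt0 //.
by rewrite addnC leq_add2l.
Qed.

(** If d(H) < d(L), then the degrees in [d(H), 1[ would include those in
    [d(L), 1[ and d(H) as well, although both sets have the same size. *)
Lemma closed_deg_eq H L : nilpotent G ->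
    ('C_G('C_G(H)) = H)%g -> ('C_G('C_G(L)) = L)%g ->
    #|` D| = (bigomega #|G : 'Z(G)|%g).+1 ->
    bigomega #|H : 'Z(G)|%g = bigomega #|L : 'Z(G)|%g ->
  d H = d L.
Proof.
move=> nilG + + eqD.
wlog: H L / d H < d L => [main clH clL eqO | ltd clH clL eqO].
  by have [/main->|/main-> |] := ltgtP (d H) (d L).
have sLG: L \subset G by rewrite -clL subsetIl.
have := closed_count_eq nilG clL eqD; rewrite -eqO -(closed_count_eq nilG clH eqD).
have sHG: H \subset G by rewrite -clH subsetIl.
move/eqP; rewrite ltn_eqF //; apply: (fset_card_lt (x := d H)) => [v||].
- by rewrite !inE /= => /and3P[-> /(lt_le_trans ltd)/ltW->].
- by rewrite !inE /= mem_rel_comm_degs // lexx (lt_le_trans ltd) ?rel_comm_deg_le1.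
by rewrite !inE /= [_ <= d H]leNgt ltd andbF.
Qed.

(** * Reduction to a central quotient of prime power order *)

(** 'C_G(B) is A times a central subgroup, which does not affect the degree. *)
Lemma dprod_deg_cent (A B : {group gT}) : (A \x B = G)%g ->
  d ('C_G(B))%G = d A.
Proof.
case/dprodP=> _ defG cAB _; have sAG: A \subset G by rewrite -defG mulG_subl.
apply/eqP; rewrite eq_le rel_comm_deg_le ?subsetI ?sAG 1?centsC //=.
rewrite -(rel_comm_deg_joing_center sAG) rel_comm_deg_le //.
apply/subsetP=> x /setIP[]; rewrite -{1}defG => /mulsgP[a b Aa Bb ->] cBab.
rewrite groupM ?(subsetP (joing_subl _ _) _ Aa) //.
apply: (subsetP (joing_subr _ _)).
have cBa: a \in 'C(B)%g by rewrite (subsetP _ _ Aa) // centsC.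
have {cBab}cBb: b \in 'C(B)%g by rewrite -(groupMl _ cBa).
rewrite inE -defG (subsetP (mulG_subr _ _)) //= centM inE cBb andbT.
exact: (subsetP cAB).
Qed.

(** Since B centralises A, the class of an element of A has a size dividing
    |G : B| = |A|; the denominator of d(A) thus involves only primes of |A|. *)
Lemma dprod_deg_denom (A B : {group gT}) : (A \x B = G)%g ->
  exists k : nat, d A * (#|A| ^ 2)%:R = k%:R.
Proof.
case/dprodP=> _ defG cAB tiAB.
have sBG: B \subset G by rewrite -defG mulG_subr.
exists (\sum_(x in A) (#|A| %/ #|(x ^: G)%g|))%N.
rewrite rel_comm_degEl natrX expr2 mulrA divfK ?card_group_neq0 //.
rewrite mulr_suml natr_sum; apply: eq_bigr => x Ax.
have dv: (#|(x ^: G)%g| %| #|A|)%N.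
  have ->: #|A| = #|G : B|%g.
    apply/eqP; rewrite -(eqn_pmul2l (cardG_gt0 B)) Lagrange // mulnC.
    by rewrite -(TI_cardMg tiAB) defG.
  rewrite -index_cent1 -(@Lagrange_index _ G 'C_G[x]%G B) ?subsetIl ?dvdn_mulr //.
  rewrite subsetI sBG sub_cent1; apply: subsetP Ax; by rewrite centsC.
rewrite natf_div // mulrC //.
Qed.

(** A quotient of order 1 or prime by a central subgroup is cyclic and would
    make 'C_G(B), hence A, abelian. *)
Lemma dprod_bigomega_cent_ge2 (A B : {group gT}) : (A \x B = G)%g ->
  ~~ (A \subset 'Z(G)%g) -> (1 < bigomega #|'C_G(B) : 'Z(G)|%g)%N.
Proof.
case/dprodP=> _ defG cAB _; have sAG: A \subset G by rewrite -defG mulG_subl.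
have sBG: B \subset G by rewrite -defG mulG_subr.
apply: contraR; rewrite -leqNgt => /bigomega_le1.
rewrite indexg_gt0 => /(_ isT) small.
have sZL: 'Z(G)%g \subset 'C_G(B)%g.
  by rewrite setIS // centS.
have nZL: ('Z(G) <| 'C_G(B))%g.
  by rewrite (normalS sZL (subsetIl _ _)) ?center_normal.
have sZZL: ('Z(G)%g \subset 'Z('C_G(B)))%g.
  by rewrite subsetI sZL (subset_trans (subsetIr _ _)) // centS // subsetIl.
have cycLZ: cyclic ('C_G(B) / 'Z(G))%g.
  move: small; rewrite -card_quotient ?normal_norm // => /orP[|/prime_cyclic //].
  by rewrite -trivg_card1 => /eqP->; apply: cyclic1.
have abL := cyclic_factor_abelian sZZL cycLZ.
have sAL: A \subset 'C_G(B)%g by rewrite subsetI sAG centsC.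
rewrite subsetI sAG /= -defG centM subsetI [A \subset 'C(B)%g]centsC cAB andbT.
exact: abelianS sAL abL.
Qed.

Lemma dprod_bigomega_center (A B : {group gT}) : (A \x B = G)%g ->
  bigomega #|G : 'Z(G)|%g
  = (bigomega #|'C_G(B) : 'Z(G)|%g + bigomega #|'C_G(A) : 'Z(G)|%g)%N.
Proof.
case/dprodP=> _ defG cAB _; have sAG: A \subset G by rewrite -defG mulG_subl.
have sBG: B \subset G by rewrite -defG mulG_subr.
have defLL: ('C_G(B) * 'C_G(A) = G)%g.
  apply/eqP; rewrite eqEsubset mul_subG ?subsetIl //=.
  by rewrite -{1}defG mulgSS // subsetI ?sAG ?sBG // centsC.
have defZ: ('C_G(B) :&: 'C_G(A) = 'Z(G))%g.
  by rewrite -setIIr -centM (centC cAB) defG.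
have sZA: 'Z(G)%g \subset 'C_G(A)%g by rewrite setIS // centS.
have sZB: 'Z(G)%g \subset 'C_G(B)%g by rewrite setIS // centS.
rewrite -bigomegaM ?indexg_gt0 //; congr bigomega.
have := mul_cardG 'C_G(B) 'C_G(A); rewrite /= defLL defZ.
rewrite -(Lagrange sZA) -(Lagrange sZB) -(Lagrange (center_sub G)) mulnACA.
rewrite [RHS]mulnAC => /eqP; rewrite eqn_pmul2l ?muln_gt0 ?cardG_gt0 //.
by rewrite eq_sym => /eqP.
Qed.

Lemma five_degs_center_index : nilpotent G -> #|` D| = 5%N ->
  exists p n : nat, [/\ prime p, #|G : 'Z(G)|%g = (p ^ n)%N & (n <= 4)%N].
Proof.
move=> nilG D5; have := bigomega_lt_degs nilG; rewrite D5 ltnS => le4.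
pose p := pdiv #|G : 'Z(G)|%g.
have [iG | iG] := leqP #|G : 'Z(G)|%g 1.
  exists 2%N, 0%N; split=> //; apply/eqP.
  by rewrite eqn_leq iG indexg_gt0.
have p_pr: prime p by apply: pdiv_prime.
have := nilpotent_pcoreC p nilG.
set A := 'O_p(G)%G; set B := 'O_p^'(G)%G => dG.
have [_ defG cAB _] := dprodP dG.
have sAG: A \subset G by rewrite -defG mulG_subl.
have sBG: B \subset G by rewrite -defG mulG_subr.
have ti: (#|A| * #|B| = #|G|)%N by apply: dprod_card dG.
have iA: #|G : A|%g = #|B| by rewrite -divgS // -ti mulKn ?cardG_gt0.
have iB: #|G : B|%g = #|A| by rewrite -divgS // -ti mulnK ?cardG_gt0.
have pA: p.-nat #|A| by apply: pcore_pgroup.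
have pB: p^'.-nat #|B| by apply: pcore_pgroup.
have [sBZ | nsBZ] := boolP (B \subset 'Z(G)%g).
  have pGZ: p.-nat #|G : 'Z(G)|%g.
    by apply: pnat_dvd pA; rewrite -iB -(Lagrange_index (center_sub G) sBZ) dvdn_mulr.
  have [n en] := p_natP pGZ; exists p, n; split=> //.
  by move: le4; rewrite en bigomegaX.
have nsAZ: ~~ (A \subset 'Z(G)%g).
  apply: contraL (pdiv_dvd #|G : 'Z(G)|%g) => sAZ.
  rewrite -/p -p'natE //; apply: pnat_dvd pB.
  by rewrite -iA -(Lagrange_index (center_sub G) sAZ) dvdn_mulr.
have dG' : (B \x A = G)%g by rewrite dprodC.
have A2 := dprod_bigomega_cent_ge2 dG nsAZ.
have B2 := dprod_bigomega_cent_ge2 dG' nsBZ.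
have sumO := dprod_bigomega_center dG.
have eqO : bigomega #|'C_G(B) : 'Z(G)|%g = bigomega #|'C_G(A) : 'Z(G)|%g.
  have aux a b : (a + b <= 4 -> 1 < a -> 1 < b -> a = b)%N by lia.
  by move: le4; rewrite sumO => le4; apply: aux A2 B2.
have eqD : #|` D| = (bigomega #|G : 'Z(G)|%g).+1.
  rewrite D5; congr _.+1; apply/eqP; rewrite eqn_leq le4 andbT sumO.
  exact: leq_add A2 B2.
have := closed_deg_eq nilG (closed_cent sBG) (closed_cent sAG) eqD eqO.
rewrite (dprod_deg_cent dG) (dprod_deg_cent dG') => eqd.
have [a ea] := dprod_deg_denom dG; have [b eb] := dprod_deg_denom dG'.
exfalso.
have eN: (a * #|B| ^ 2 = b * #|A| ^ 2)%N.
  apply/eqP; rewrite -(eqr_nat rat) (natrM _ a) (natrM _ b) -ea -eb eqd.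
  by rewrite mulrAC.
(* The cross-multiplied equality forces #|A| ^ 2 to divide the numerator of d(A). *)
have coAB: coprime (#|A| ^ 2) (#|B| ^ 2).
  by apply: (@pnat_coprime p); rewrite pnatX ?pA ?pB.
have dvA: (#|A| ^ 2 %| a)%N.
  by rewrite -(Gauss_dvdl _ coAB) eN; apply: dvdn_mull.
have dA_int: d A = (a %/ #|A| ^ 2)%:R.
  by rewrite natf_div // -ea mulfK // natrX expf_neq0 ?card_group_neq0.
have d0: 0 < d A by apply: rel_comm_deg_gt0.
have d1: d A < 1 by apply: rel_comm_deg_lt1.
move: d0 d1; rewrite dA_int ltr0n -[1]/(1%:R) ltr_nat; by case: (a %/ _)%N.
Qed.

(** * Degrees computed from class sizes *)

Lemma sum_const_inv (A B : {group gT}) (F : gT -> rat) c :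
    B \subset A -> {in A :\: B, forall h, F h = c} ->
  \sum_(h in A :\: B) F h = (#|A|%:R - #|B|%:R) * c.
Proof.
move=> sBA eF; rewrite (eq_bigr (fun _ => c)) // sumr_const cardsD (setIidPr sBA).
by rewrite -[LHS]mulr_natl natrB ?subset_leq_card.
Qed.

Lemma class_of_central z : z \in 'Z(G)%g -> (z ^: G)%g = [set z].
Proof.
move=> Zz; apply/setP => y; rewrite inE; apply/imsetP/eqP => [[g Gg ->] | ->].
  by rewrite conjgE -(centerC Gg Zz) mulKg.
by exists 1%g; rewrite ?group1 ?conjg1.
Qed.

(** The shape in which degrees are computed when G has an abelian maximal
    subgroup M: N is then the intersection of H and M. *)
Lemma deg_layers (N H : {group gT}) (c1 c2 : nat) :
    'Z(G)%g \subset N -> N \subset H ->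
    {in N :\: 'Z(G)%g, forall h, #|(h ^: G)%g| = c1} ->
    {in H :\: N, forall h, #|(h ^: G)%g| = c2} ->
  d H = (1 + (#|N : 'Z(G)|%g%:R - 1) / c1%:R
           + (#|H : 'Z(G)|%g%:R - #|N : 'Z(G)|%g%:R) / c2%:R)
        / #|H : 'Z(G)|%g%:R.
Proof.
move=> sZN sNH e1 e2; have sZH := subset_trans sZN sNH.
rewrite rel_comm_degEl (big_setID N) (setIidPr sNH) (big_setID 'Z(G)%g) (setIidPr sZN) /=.
rewrite (sum_const_inv (c := c1%:R^-1)) => [||h /e1-> //] //.
rewrite (sum_const_inv (c := c2%:R^-1)) => [||h /e2-> //] //.
rewrite (eq_bigr (fun _ => 1)) => [|z Zz]; last first.
  by rewrite class_of_central ?cards1 ?invr1.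
rewrite sumr_const -(Lagrange sZN) -(Lagrange sZH) !natrM.
have b0: #|H : 'Z(G)|%g%:R != 0 :> rat by rewrite pnatr_eq0 -lt0n indexg_gt0.
have := card_group_neq0 'Z(G)%G; move: b0.
move: (#|H : 'Z(G)|%g%:R) (#|N : 'Z(G)|%g%:R) (#|'Z(G)%g|%:R) => b a z b0 z0.
move: (c1%:R^-1) (c2%:R^-1) => x1 x2.
by field; apply/andP.
Qed.

Lemma deg_uniform (H : {group gT}) (c : nat) :
    'Z(G)%g \subset H ->
    {in H :\: 'Z(G)%g, forall h, #|(h ^: G)%g| = c} ->
  d H = uniform_deg c #|H : 'Z(G)|%g.
Proof.
move=> sZH e; rewrite (deg_layers (c1 := c) (c2 := c) sZH (subxx H)) //; last first.
  by rewrite setDv => x; rewrite inE.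
have: #|H : 'Z(G)|%g%:R != 0 :> rat by rewrite pnatr_eq0 -lt0n indexg_gt0.
rewrite /uniform_deg; move: (c%:R^-1) (_%:R) => x b b0.
by field.
Qed.

Lemma deg_lt_uniform (H : {group gT}) (c : nat) y :
    'Z(G)%g \subset H -> (0 < c)%N ->
    {in H :\: 'Z(G)%g, forall h, c <= #|(h ^: G)%g|}%N ->
    y \in H :\: 'Z(G)%g -> (c < #|(y ^: G)%g|)%N ->
  d H < uniform_deg c #|H : 'Z(G)|%g.
Proof.
move=> sZH c0 lec HZy ltc.
have ->: uniform_deg c #|H : 'Z(G)|%g =
    (\sum_(h in H) (if h \in 'Z(G)%g then 1 else c%:R^-1)) / #|H|%:R.
  rewrite (big_setID 'Z(G)%g) (setIidPr sZH) /=.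
  rewrite (sum_const_inv (c := c%:R^-1)) => [||h /setDP[_ /negPf->] //] //.
  rewrite (eq_bigr (fun _ => 1)) => [|z -> //].
  rewrite sumr_const -(Lagrange sZH) !natrM.
  have b0: #|H : 'Z(G)|%g%:R != 0 :> rat by rewrite pnatr_eq0 -lt0n indexg_gt0.
  have := card_group_neq0 'Z(G)%G; rewrite /uniform_deg; move: b0.
  move: (#|H : 'Z(G)|%g%:R) (#|'Z(G)%g|%:R) => b z b0 z0.
  by move: (c%:R^-1) => x; field; apply/andP.
rewrite rel_comm_degEl ltr_pM2r ?invr_gt0 ?ltr0n ?cardG_gt0 //.
have [Hy nZy] := setDP HZy.
rewrite (bigD1 y) //= [ltRHS](bigD1 y) //= (negPf nZy) ltr_leD //.
  by rewrite ltf_pV2 ?posrE ?ltr0n ?ltr_nat // (ltn_trans c0).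
apply: ler_sum => h /andP[Hh _]; case: ifPn => Zh.
  by rewrite invf_le1 ?ler1n ?ltr0n ?card_class_gt0.
have lech: (c <= #|(h ^: G)%g|)%N by rewrite lec // inE Zh.
by rewrite lef_pV2 ?posrE ?ltr0n ?ler_nat // (leq_trans c0).
Qed.

Lemma class_gt1 x : x \in G :\: 'Z(G)%g -> (1 < #|(x ^: G)%g|)%N.
Proof.
case/setDP=> Gx nZx; rewrite -index_cent1 ltn_neqAle indexg_gt0 andbT eq_sym.
apply: contra nZx; rewrite indexg_eq1 subsetI subxx /= inE Gx /= => sGC.
by apply/centP => y Gy; apply/commute_sym/cent1P/(subsetP sGC).
Qed.

Lemma center_sub_cent1 x : x \in G -> 'Z(G)%g \subset 'C_G[x]%g.
Proof.
move=> Gx; apply/subsetP => z /setIP[Gz /centP cz]; rewrite inE Gz.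
by apply/cent1P/cz.
Qed.

Lemma class_index x : x \in G ->
  (#|(x ^: G)%g| * #|'C_G[x] : 'Z(G)|%g = #|G : 'Z(G)|%g)%N.
Proof.
by move=> Gx; rewrite -index_cent1 Lagrange_index ?subsetIl ?center_sub_cent1.
Qed.

Lemma noncentral_class p n x : prime p -> #|G : 'Z(G)|%g = (p ^ n)%N ->
  x \in G :\: 'Z(G)%g -> 
  exists e, [/\ (0 < e < n)%N, #|(x ^: G)%g| = (p ^ e)%N
                & #|'C_G[x] : 'Z(G)|%g = (p ^ (n - e))%N].
Proof.
move=> p_pr oGZ GZx; have [Gx nZx] := setDP GZx; have p1 := prime_gt1 p_pr.
have := class_index Gx; rewrite oGZ => def.
have: (#|(x ^: G)%g| %| p ^ n)%N by rewrite -def dvdn_mulr.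
case/(dvdn_pfactor _ _ p_pr) => e len oe.
have oC : #|'C_G[x] : 'Z(G)|%g = (p ^ (n - e))%N.
  apply/eqP; rewrite -(eqn_pmul2l (_ : 0 < p ^ e)%N) ?expn_gt0 ?prime_gt0 //.
  by rewrite -{1}oe def -expnD subnKC.
exists e; split=> //; have := class_gt1 GZx; rewrite oe -{1}(expn0 p) ltn_exp2l // => ->.
rewrite ltn_neqAle len andbT; apply: contraNneq nZx => en.
move: oC; rewrite en subnn expn0 => /eqP; rewrite indexg_eq1 => /subsetP; apply.
by rewrite inE Gx cent1id.
Qed.

(** Any noncentral h generates X together with the centre, so centralising h
    amounts to centralising X: all noncentral elements of X have classes of the
    same size. *)
Lemma prime_center_index_cent (X : {group gT}) h :
    'Z(G)%g \subset X -> X \subset G -> prime #|X : 'Z(G)|%g ->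
  h \in X :\: 'Z(G)%g -> ('C_G[h] = 'C_G(X))%g.
Proof.
move=> sZX sXG prX /setDP[Xh nZh].
have sYX: (<[h]> <*> 'Z(G))%G \subset X by rewrite join_subG cycle_subG Xh.
have sZY: 'Z(G)%g \subset (<[h]> <*> 'Z(G))%G by rewrite joing_subr.
suff eqY: X \subset (<[h]> <*> 'Z(G))%G.
  apply/eqP; rewrite eqEsubset; apply/andP; split; last first.
    by rewrite setIS // -cent_set1 centS // sub1set.
  rewrite subsetI subsetIl /= (subset_trans _ (centS eqY)) //= centY cent_cycle.
  by rewrite subsetI subsetIr (subset_trans (subsetIl _ _)) // centsC subsetIr.
have factor a b : (0 < b)%N -> b != 1%N -> prime (a * b) -> (a == 1)%N.
  move=> b0 b1 /primeP[_ /(_ b (dvdn_mull _ (dvdnn b)))].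
  by rewrite (negPf b1) /= -{1}[b]mul1n eqn_pmul2r // eq_sym.
rewrite -indexg_eq1; set Y := (<[h]> <*> 'Z(G))%G in sYX sZY *.
apply: (factor #|X : Y|%g #|Y : 'Z(G)|%g).
- exact: indexg_gt0.
- apply: contraNneq nZh => /eqP; rewrite indexg_eq1 join_subG cycle_subG.
  by case/andP.
by rewrite Lagrange_index.
Qed.

Definition cycZ x : {group gT} := (<[x]> <*> 'Z(G))%G.

Lemma cycZ_sub x : x \in G -> cycZ x \subset G.
Proof. by move=> Gx; rewrite join_subG cycle_subG Gx center_sub. Qed.

Lemma coset_center_cycle x : x \in G -> (cycZ x / 'Z(G))%g = <[coset 'Z(G) x]>%g.
Proof.
move=> Gx; have nZx : x \in 'N('Z(G))%g := subsetP (normal_norm (center_normal G)) x Gx.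
by rewrite quotientYidr ?cycle_subG // quotient_cycle.
Qed.

Lemma cycZ_index x : x \in G -> #|cycZ x : 'Z(G)|%g = #[coset 'Z(G) x]%g.
Proof.
move=> Gx; rewrite orderE -coset_center_cycle // card_quotient //.
exact: subset_trans (cycZ_sub Gx) (normal_norm (center_normal G)).
Qed.

Lemma prime_coset_noncentral x : x \in G -> prime #[coset 'Z(G) x]%g ->
  x \in G :\: 'Z(G)%g.
Proof.
move=> Gx pr; rewrite inE Gx andbT; apply: contraL pr => Zx.
by rewrite coset_id // order1.
Qed.

Lemma deg_prime_cycZ x : x \in G -> prime #[coset 'Z(G) x]%g ->
  d (cycZ x) = uniform_deg #|(x ^: G)%g| #[coset 'Z(G) x]%g.
Proof.
move=> Gx pr; rewrite -cycZ_index //; apply: deg_uniform => [|h Xh].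
  exact: joing_subr.
have sXG := cycZ_sub Gx; have sZX : 'Z(G)%g \subset cycZ x by apply: joing_subr.
have prX: prime #|cycZ x : 'Z(G)|%g by rewrite cycZ_index.
rewrite -!index_cent1 (prime_center_index_cent sZX sXG prX Xh).
rewrite (prime_center_index_cent sZX sXG prX (h := x)) //.
have [_ nZx] := setDP (prime_coset_noncentral Gx pr).
by rewrite inE nZx mem_gen // inE cycle_id.
Qed.

(** Passing to such a power cannot enlarge the class ([class_power_le]): if some
    noncentral class is smaller than the largest one, then so is the class of
    some element of order p modulo the centre. *)
Lemma prime_order_mod_center p n y : prime p -> #|G : 'Z(G)|%g = (p ^ n)%N ->
    y \in G :\: 'Z(G)%g ->
  exists2 x, x \in <[y]>%g & #[coset 'Z(G) x]%g = p.
Proof.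
move=> p_pr oGZ /setDP[Gy nZy].
have nZ := subsetP (normal_norm (center_normal G)).
have: (#[coset 'Z(G) y]%g %| p ^ n)%N.
  by rewrite -cycZ_index // -oGZ -(Lagrange_index (cycZ_sub Gy) (joing_subr _ _)) dvdn_mull.
case/(dvdn_pfactor _ _ p_pr) => -[|e] _ oy.
  case/negP: nZy; apply: coset_idr (nZ y Gy) _; apply/eqP.
  by rewrite -order_eq1 oy.
exists (y ^+ (p ^ e))%g; first exact: mem_cycle.
by rewrite morphX ?nZ // (orderXexp _ oy) subSnn expn1.
Qed.

Lemma class_power_le x y : x \in <[y]>%g -> (#|(x ^: G)%g| <= #|(y ^: G)%g|)%N.
Proof.
move=> xy; rewrite -!index_cent1 dvdn_leq ?indexg_gt0 // indexgS //.
by apply: setIS; rewrite /= -['C[y]%g]cent_cycle -['C[x]%g]cent_cycle centS ?cycle_subG.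
Qed.

End Chains.

(** * Central quotient of order p^4 *)

Section FiveDegrees.
Variables (gT : finGroupType) (G : {group gT}).
Implicit Types H K L X : {group gT}.

Local Notation D := (rel_comm_degs G).
Local Notation d H := (rel_comm_deg H G).

(** Take x of order p modulo Z and central modulo Z, and g not commuting with x.
    A power y of g has order p modulo Z, and it does not lie in <x>Z: otherwise
    x would lie in <y>Z, and so commute with g. The images of x and y then
    generate the required subgroup. This excludes central quotients such as
    cyclic or generalised quaternion groups. *)
Lemma exists_elementary_p2 p n : prime p -> #|G : 'Z(G)|%g = (p ^ n)%N ->
    (0 < n)%N ->
  exists K : {group gT}, [/\ 'Z(G)%g \subset K, K \subset G, #|K : 'Z(G)|%g = (p ^ 2)%N
    & {in K :\: 'Z(G)%g, forall k, #[coset 'Z(G) k]%g = p}].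
Proof.
move=> p_pr oGZ n0; have nZG := normal_norm (center_normal G).
have nZ := subsetP nZG.
have oQ: #|G / 'Z(G)|%g = (p ^ n)%N by rewrite card_quotient.
have pQ: (p.-group (G / 'Z(G)))%g by rewrite /pgroup oQ pnatX pnat_id.
have ntQ: (G / 'Z(G))%g != 1%g.
  by rewrite trivg_card1 oQ -(expn0 p) eqn_exp2l ?prime_gt1 // -lt0n.
have ntZQ: ('Z(G / 'Z(G)) != 1)%g by rewrite (center_nil_eq1 (pgroup_nil pQ)).
have [_ pdiv _] := pgroup_pdiv (pgroupS (center_sub _) pQ) ntZQ.
have [xb Zxb oxb] := Cauchy p_pr pdiv.
have /centerP[Qxb cxb] := Zxb.
case/morphimP: Qxb => x nZx Gx /= exb.
have ox: #[coset 'Z(G) x]%g = p by rewrite -exb.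
have GZx: x \in G :\: 'Z(G)%g by apply: prime_coset_noncentral; rewrite ?ox.
have [g Gg ncxg]: exists2 g, g \in G & ~ commute x g.
  have [_ nZx'] := setDP GZx.
  have /subsetPn[g Gg ncg]: ~~ (G \subset 'C[x])%g.
    by apply: contra nZx'; rewrite sub_cent1 => cGx; rewrite inE Gx.
  by exists g => // /commute_sym/cent1P; rewrite (negPf ncg).
have GZg: g \in G :\: 'Z(G)%g.
  rewrite inE Gg andbT; apply/negP => /centerP[_ cg].
  by apply: ncxg; apply: commute_sym; apply: cg.
have [y gy oy] := prime_order_mod_center p_pr oGZ GZg.
have Gy : y \in G by apply: (subsetP _ y gy); rewrite cycle_subG.
set X := <[coset 'Z(G) x]>%G; set Y := <[coset 'Z(G) y]>%G.
have tiXY: (X :&: Y = 1)%g.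
  apply: prime_TIg; first by rewrite -orderE ox.
  rewrite cycle_subG; apply/negP => xY.
  case: ncxg.
  have nsZY: ('Z(G) <| cycZ G y)%g.
    by rewrite /normal joing_subr (subset_trans (cycZ_sub Gy)).
  have {}xY: x \in cycZ G y by rewrite -(quotientGK nsZY) mem_morphpre ?nZ ?coset_center_cycle.
  apply/cent1P; apply: (subsetP _ x xY); rewrite join_subG; apply/andP; split.
    by rewrite cycle_subG; apply/cent1P; have /cycleP[i ->] := gy; apply/commute_sym/commuteX.
  by apply: subset_trans (center_sub_cent1 Gg) (subsetIr _ _).
have cXY: Y \subset 'C(X)%g.
  rewrite cent_cycle cycle_subG; apply/cent1P; rewrite -exb; apply: commute_sym.
  by apply: cxb; apply: mem_quotient.
have dXY := dprodEY cXY tiXY.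
have abXY: (p.-abelem (X <*> Y))%g.
  by rewrite (dprod_abelem p dXY) !prime_abelem // -orderE.
have sXYQ: (X <*> Y)%G \subset (G / 'Z(G))%g.
  by rewrite join_subG !cycle_subG !mem_quotient.
have sKG: (coset 'Z(G) @*^-1 (X <*> Y))%g \subset G.
  by have := morphpreS (coset_morphism _) sXYQ; rewrite quotientGK ?center_normal.
have sZK: 'Z(G)%g \subset (coset 'Z(G) @*^-1 (X <*> Y))%g by apply: sub_cosetpre.
exists (coset 'Z(G) @*^-1 (X <*> Y))%G; split=> // [|k /setDP[Kk nZk]].
  rewrite -card_quotient ?(subset_trans sKG) //= cosetpreK.
  by rewrite -(dprod_card dXY) -!orderE ox oy.
have Gk := subsetP sKG k Kk.
apply: (abelem_order_p abXY).
  by case/morphpreP: Kk.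
by apply: contraNneq nZk => /(coset_idr (nZ k Gk)).
Qed.

(** Only 4 - e degrees lie in [d(L), 1[, where L is the centraliser of an element
    y with a class of the maximal size p^e; an element of smaller class size
    always provides one degree too many there. *)
Lemma five_degs_uniform p : nilpotent G -> #|` D| = 5%N -> prime p ->
    #|G : 'Z(G)|%g = (p ^ 4)%N ->
  exists2 m, (0 < m < 4)%N &
    {in G :\: 'Z(G)%g, forall x, #|(x ^: G)%g| = (p ^ m)%N}.
Proof.
move=> nilG D5 p_pr oGZ; have p1 := prime_gt1 p_pr; have p0 := prime_gt0 p_pr.
have eqD: #|` D| = (bigomega #|G : 'Z(G)|%g).+1 by rewrite oGZ bigomegaX.
have [K [sZK sKG oK expK]] := exists_elementary_p2 p_pr oGZ isT.
have [y0 GZy0]: exists y0, y0 \in G :\: 'Z(G)%g.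
  have /subsetPn[y0 Gy0 nZy0]: ~~ (G \subset 'Z(G)%g).
    by rewrite -indexg_eq1 oGZ -(expn0 p) eqn_exp2l.
  by exists y0; rewrite inE nZy0.
case: (arg_maxnP (P := mem (G :\: 'Z(G)%g)) (fun x => #|(x ^: G)%g|) GZy0) => y GZy maxy.
have [Gy nZy] := setDP GZy.
have [e [/andP[e0 e4] oy oL]] := noncentral_class p_pr oGZ GZy.
pose L := ('C_G[y])%G.
have clL: ('C_G('C_G(L)) = L)%g by rewrite /= -cent_set1 closed_cent // sub1set.
have sLG: L \subset G by apply: subsetIl.
have sZL: 'Z(G)%g \subset L by apply: center_sub_cent1.
have LZy : y \in L :\: 'Z(G)%g by rewrite inE nZy inE Gy cent1id.
have := closed_count_eq nilG clL eqD; rewrite oL bigomegaX // => few.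
pose S := [fset v in D | (d L <= v < 1)%R]%fset.
have SP X : X \subset G -> d L < d X -> d X < 1 -> d X \in S.
  by move=> sXG ltLX ltX1; rewrite !inE /= mem_rel_comm_degs // ltW.
have SL : d L \in S.
  rewrite !inE /= mem_rel_comm_degs // lexx rel_comm_deg_lt1 //.
  by apply: contra nZy => /subsetP; apply; case/setDP: LZy.
have card_ge s : uniq s -> {subset s <= S} -> (size s <= 4 - e)%N.
  by rewrite -few; apply: uniq_leq_size.
have classX x : x \in G :\: 'Z(G)%g ->
    exists2 j, (0 < j <= e)%N & #|(x ^: G)%g| = (p ^ j)%N.
  move=> GZx; have [j [/andP[j0 _] oj _]] := noncentral_class p_pr oGZ GZx.
  exists j => //; rewrite j0 -(leq_exp2l _ _ p1) -oj -oy; exact: maxy.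
exists e; first by rewrite e0.
move=> x GZx. apply/eqP; apply: contraT => neq_x.
have [x1 xx1 ox1] := prime_order_mod_center p_pr oGZ GZx.
have Gx1: x1 \in G.
  by apply: (subsetP _ x1 xx1); rewrite cycle_subG; case/setDP: GZx.
have GZx1: x1 \in G :\: 'Z(G)%g by apply: prime_coset_noncentral; rewrite ?ox1.
have [j /andP[j0 lej] oj] := classX _ GZx1.
have ltj: (j < e)%N.
  have [i /andP[i0 lei] oi] := classX _ GZx.
  rewrite -(ltn_exp2l _ _ p1) -oj (leq_ltn_trans (class_power_le _ xx1)) //.
  by rewrite oi ltn_exp2l // ltn_neqAle lei andbT; apply: contraNneq neq_x => <-; rewrite oi.
have dx1: d (cycZ G x1) = uniform_deg (p ^ j) p.
  by rewrite deg_prime_cycZ ?ox1 // oj.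
have dx1_lt1: d (cycZ G x1) < 1.
  rewrite dx1 -(uniform_deg1 (p ^ j)) uniform_deg_anti ?p1 //.
  by rewrite -(expn0 p) ltn_exp2l.
have : (e == 2) || (e == 3) by move: e4 j0 ltj; clear; lia.
case/orP=> /eqP e_eq; subst e; last first.
  (* Largest class size p^3: L has index p over Z, and
     [d(L), 1[ contains only one degree. *)
  have dL: d L = uniform_deg (p ^ 3) p.
    rewrite (deg_uniform (c := p ^ 3) sZL) ?oL // => h LZh.
    rewrite -oy -!index_cent1.
    have prL: prime #|L : 'Z(G)|%g by rewrite oL.
    by rewrite !(prime_center_index_cent sZL sLG prL).
  have ltL: d L < d (cycZ G x1).
    rewrite dL dx1 ![uniform_deg _ p]uniform_degC uniform_deg_anti //.
    by rewrite expn_gt0 p0 ltn_exp2l.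
  suff: (2 <= 4 - 3)%N by [].
  apply: (card_ge [:: d L; d (cycZ G x1)]) => [|v].
    by rewrite [uniq _]/= in_cons in_nil lt_eqF.
  rewrite !in_cons in_nil orbF => /orP[] /eqP-> //.
  by apply: SP => //; apply: cycZ_sub.
(* Largest class size p^2: [d(L), 1[ contains only two degrees. *)
have {j0 lej ltj} ? : j = 1%N by move: j0 ltj; clear; lia.
subst j; rewrite expn1 in dx1 oj.
have leC h : h \in G :\: 'Z(G)%g -> (p <= #|(h ^: G)%g|)%N.
  by case/classX => i /andP[i0 _] ->; rewrite -{1}(expn1 p) leq_exp2l.
have dL: d L < uniform_deg p (p ^ 2).
  rewrite -[X in uniform_deg _ X]oL.
  apply: (deg_lt_uniform sZL p0) LZy _ => [h /setDP[Lh nZh]|].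
    by apply: leC; rewrite inE nZh (subsetP sLG).
  by rewrite oy -{1}(expn1 p) ltn_exp2l.
have ltu : uniform_deg p (p ^ 2) < uniform_deg p p.
  by rewrite uniform_deg_anti // p0 -{1}(expn1 p) ltn_exp2l.
(* If all noncentral classes of K have size p, then K has this degree;
   otherwise an element of K with a class of size p^2 has order p modulo Z and
   gives the same degree by symmetry of uniform_deg. *)
have [X sXG dX]: exists2 X : {group gT}, X \subset G & d X = uniform_deg p (p ^ 2).
  have [allp | ] := boolP [forall h in K :\: 'Z(G)%g, #|(h ^: G)%g| == p].
    exists K => //; rewrite (deg_uniform (c := p)) ?oK // => h KZh.
    by apply/eqP; apply: (forall_inP allp).
  case/forall_inPn=> h KZh neq_h; have [Kh nZh] := setDP KZh.
  have Gh := subsetP sKG h Kh; have oh := expK h KZh.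
  exists (cycZ G h); first exact: cycZ_sub.
  rewrite deg_prime_cycZ ?oh // uniform_degC; congr uniform_deg.
  have [|i /andP[i0 i2] oi] := classX h; first by rewrite inE nZh.
  have -> : #|(h ^: G)%g| = (p ^ 2)%N.
    rewrite oi; congr (p ^ _)%N; apply/eqP; rewrite eqn_leq i2 /= ltnNge.
    apply: contra neq_h => i1; rewrite oi (_ : i = 1%N) ?expn1 //.
    by apply/eqP; rewrite eqn_leq i1.
  by [].
suff: (3 <= 4 - 2)%N by [].
apply: (card_ge [:: d L; d X; d (cycZ G x1)]) => [|v].
  rewrite [uniq _]/= !in_cons in_nil !orbF dX dx1.
  by rewrite (lt_eqF dL) (lt_eqF ltu) (lt_eqF (lt_trans dL ltu)).
rewrite !in_cons in_nil orbF => /or3P[] /eqP-> //.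
  by rewrite SP // dX // (lt_trans ltu) -?dx1.
by rewrite SP ?cycZ_sub // dx1 (lt_trans dL).
Qed.

(** * Uniform class sizes and central quotients of small order *)

Lemma exists_center_index p n k : prime p -> #|G : 'Z(G)|%g = (p ^ n)%N ->
    (k <= n)%N ->
  exists H : {group gT}, [/\ 'Z(G)%g \subset H, H \subset G & #|H : 'Z(G)|%g = (p ^ k)%N].
Proof.
move=> p_pr oGZ lekn; have nZG := normal_norm (center_normal G).
have oQ: #|G / 'Z(G)|%g = (p ^ n)%N by rewrite card_quotient.
have pQ: (p.-group (G / 'Z(G)))%g by rewrite /pgroup oQ pnatX pnat_id.
have lek: (k <= logn p #|G / 'Z(G)|%g)%N by rewrite oQ pfactorK.
have [Q [sQG _ oH]] := normal_pgroup pQ (normal_refl _) lek.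
exists (coset 'Z(G) @*^-1 Q)%G.
have sHG: (coset 'Z(G) @*^-1 Q)%g \subset G.
  by have := morphpreS (coset_morphism _) sQG; rewrite quotientGK ?center_normal.
split=> //; first exact: sub_cosetpre.
by rewrite -card_quotient ?(subset_trans sHG) //= cosetpreK.
Qed.

Lemma rel_comm_degs_centerP v :
  reflect (exists H : {group gT}, [/\ 'Z(G)%g \subset H, H \subset G & v = d H])
          (v \in D).
Proof.
apply: (iffP (rel_comm_degsP _ _)) => [[H sHG ->] | [H [_ sHG ->]]]; last by exists H.
exists (H <*> 'Z(G))%G; split; first exact: joing_subr.
  by rewrite join_subG sHG center_sub.
by rewrite [RHS](rel_comm_deg_joing_center sHG).
Qed.

Lemma rel_comm_degs_uniform p n c : prime p -> #|G : 'Z(G)|%g = (p ^ n)%N ->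
    {in G :\: 'Z(G)%g, forall x, #|(x ^: G)%g| = c} ->
  D = [fset v in [seq uniform_deg c (p ^ k) | k <- iota 0 n.+1]]%fset.
Proof.
move=> p_pr oGZ ec; apply/fsetP => v; rewrite in_fset.
have dH (H : {group gT}) : 'Z(G)%g \subset H -> H \subset G ->
    d H = uniform_deg c #|H : 'Z(G)|%g.
  move=> sZH sHG; apply: deg_uniform => // h /setDP[Hh nZh].
  by apply: ec; rewrite inE nZh (subsetP sHG).
apply/rel_comm_degs_centerP/mapP => [[H [sZH sHG ->]] | [k]].
  have: (#|H : 'Z(G)|%g %| p ^ n)%N by rewrite -oGZ -(Lagrange_index sHG sZH) dvdn_mull.
  case/(dvdn_pfactor _ _ p_pr) => k lek ok; exists k; first by rewrite mem_iota.
  by rewrite dH // ok.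
rewrite mem_iota /= add0n ltnS => lekn ->.
have [H [sZH sHG oH]] := exists_center_index p_pr oGZ lekn.
by exists H; rewrite dH // oH.
Qed.

Lemma card_degs_uniform_le p n c : prime p -> #|G : 'Z(G)|%g = (p ^ n)%N ->
    {in G :\: 'Z(G)%g, forall x, #|(x ^: G)%g| = c} ->
  (#|` D| <= n.+1)%N.
Proof.
move=> p_pr oGZ ec; rewrite (rel_comm_degs_uniform p_pr oGZ ec) card_fseq.
by rewrite (leq_trans (size_undup _)) // size_map size_iota.
Qed.

Lemma card_degs_uniform p n c : prime p -> #|G : 'Z(G)|%g = (p ^ n)%N ->
    {in G :\: 'Z(G)%g, forall x, #|(x ^: G)%g| = c} -> (1 < c)%N ->
  #|` D| = n.+1.
Proof.
move=> p_pr oGZ ec c1; rewrite (rel_comm_degs_uniform p_pr oGZ ec) card_fseq.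
rewrite undup_id ?size_map ?size_iota // map_inj_in_uniq ?iota_uniq // => i j _ _.
have anti a b : (a < b)%N -> uniform_deg c (p ^ b) < uniform_deg c (p ^ a).
  by move=> ltab; rewrite uniform_deg_anti // expn_gt0 prime_gt0 //= ltn_exp2l // prime_gt1.
by case: (ltngtP i j) => [/anti lt|/anti lt|//] e; move: lt; rewrite e ltxx.
Qed.

Lemma class_sizes_uniformP c : ~~ abelian G ->
  {in G :\: 'Z(G)%g, forall x, #|(x ^: G)%g| = c} <->
  class_sizes G = [fset 1%N; c]%fset.
Proof.
move=> nabG; have [x GZx]: exists x, x \in G :\: 'Z(G)%g.
  by have /subsetPn[x Gx nZx] := nabG; exists x; rewrite inE Gx andbT /center inE Gx.
have mem_sizes k : reflect (exists2 g, g \in G & k = #|(g ^: G)%g|) (k \in class_sizes G).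
  apply: (iffP (imfsetP _ _ _ _)) => [[_ /= /imsetP[g Gg ->] ->] | [g Gg ->]].
    by exists g.
  by exists (g ^: G)%g; rewrite //= mem_classes.
split=> [ec | eS y GZy].
  apply/fsetP => k; rewrite in_fset2; apply/mem_sizes/orP => [[g Gg ->] | []/eqP->].
  - have [Zg | nZg] := boolP (g \in 'Z(G)%g); last by right; rewrite ec // inE nZg.
    by left; rewrite (class_of_central Zg) cards1.
  - by exists 1%g; rewrite // (class_of_central (group1 _)) cards1.
  by exists x; rewrite ?ec //; case/setDP: GZx.
have: #|(y ^: G)%g| \in class_sizes G.
  by apply/mem_sizes; exists y => //; case/setDP: GZy.
by rewrite eS in_fset2 gtn_eqF ?class_gt1 //= => /eqP.
Qed.

(** x and Z are central in 'C_G[x] and generate a subgroup of index 1 or p. *)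
Lemma cent1_center_index_p2_abelian p x : prime p -> x \in G :\: 'Z(G)%g ->
  #|'C_G[x] : 'Z(G)|%g = (p ^ 2)%N -> abelian 'C_G[x].
Proof.
move=> p_pr GZx oC; have [Gx nZx] := setDP GZx.
have sXC: cycZ G x \subset 'C_G[x]%g.
  by rewrite join_subG cycle_subG center_sub_cent1 // inE Gx cent1id.
have sXZ: cycZ G x \subset 'Z('C_G[x])%g.
  rewrite subsetI sXC centsC /= centY subsetI cent_cycle subsetIr.
  by rewrite (subset_trans (subsetIl _ _)) // centsC subsetIr.
have nXC : ('C_G[x])%g \subset 'N(cycZ G x)%g.
  by rewrite cents_norm // centsC (subset_trans sXZ) // subsetIr.
apply: (cyclic_factor_abelian sXZ).
have sZX: 'Z(G)%g \subset cycZ G x by apply: joing_subr.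
have: #|'C_G[x] : cycZ G x|%g != (p ^ 2)%N.
  apply: contra nZx => /eqP eC.
  have: #|cycZ G x : 'Z(G)|%g == 1%N.
    rewrite -(eqn_pmul2l (_ : 0 < p ^ 2)%N) ?expn_gt0 ?prime_gt0 // muln1.
    by rewrite -{1}eC -oC Lagrange_index.
  by rewrite indexg_eq1 join_subG cycle_subG => /andP[].
have: (#|'C_G[x] : cycZ G x|%g %| p ^ 2)%N.
  by rewrite -oC -(Lagrange_index sXC sZX) dvdn_mulr.
rewrite -card_quotient // => /(dvdn_pfactor _ _ p_pr)[[|[|[|]]]] //.
- by rewrite expn0 => _ /eqP; rewrite -trivg_card1 => /eqP->; rewrite cyclic1.
- by rewrite expn1 => _ o; rewrite prime_cyclic ?o.
by move=> _ ->; rewrite eqxx.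
Qed.

Lemma five_degs_index_le3 p n : #|` D| = 5%N -> prime p ->
    #|G : 'Z(G)|%g = (p ^ n)%N -> (n <= 3)%N ->
  n = 3%N /\ exists M : {group gT}, maximal M G /\ abelian M.
Proof.
move=> D5 p_pr oGZ n3.
have not_uniform c : ~ {in G :\: 'Z(G)%g, forall x, #|(x ^: G)%g| = c}.
  by move=> ec; have := card_degs_uniform_le p_pr oGZ ec; rewrite D5 ltnS leqNgt ltnS n3.
have [/forall_inP all | /forall_inPn[x GZx]] :=
  boolP [forall x in G :\: 'Z(G)%g, #|(x ^: G)%g| == (p ^ n.-1)%N].
  by case: (not_uniform (p ^ n.-1)%N) => x /all/eqP.
have [e [/andP[e0 en] ex oC]] := noncentral_class p_pr oGZ GZx.
rewrite ex => neq; have ne : e != n.-1 by apply: contraNneq neq => ->.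
have [? ?] : n = 3%N /\ e = 1%N by move: n3 e0 en ne; clear; lia.
subst n e; split=> //; exists ('C_G[x])%G; split; last exact: cent1_center_index_p2_abelian oC.
by rewrite p_index_maximal ?subsetIl // index_cent1 ex.
Qed.

(** * Abelian maximal subgroup *)

(** For noncentral x in M, the centraliser of x contains M and is not G, so it is
    M. For x outside M, an element of M commuting with x commutes with M and x,
    which generate G; so 'C_G[x] meets M in Z, which leaves only index p over Z
    for 'C_G[x]. *)
Lemma abelian_maximal_classes p (M : {group gT}) : nilpotent G -> prime p ->
    #|G : 'Z(G)|%g = (p ^ 3)%N -> maximal M G -> abelian M ->
  [/\ 'Z(G)%g \subset M, #|M : 'Z(G)|%g = (p ^ 2)%N, #|G : M|%g = p,
      {in M :\: 'Z(G)%g, forall x, #|(x ^: G)%g| = p}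
    & {in G :\: M, forall x, #|(x ^: G)%g| = (p ^ 2)%N}].
Proof.
move=> nilG p_pr oGZ maxM abM; have p1 := prime_gt1 p_pr; have p0 := prime_gt0 p_pr.
have prM := maxgroupp maxM; have sMG := proper_sub prM.
have maxP (H : {group gT}) : M \subset H -> H \subset G -> (H :=: M) \/ (H :=: G).
  move=> sMH; rewrite subEproper => /orP[/eqP-> | prH]; first by right.
  by left; case/maxgroupP: maxM => _ /(_ H prH sMH).
have sZM: 'Z(G)%g \subset M.
  have cMZ: 'Z(G)%g \subset 'C(M)%g by rewrite centsC (subset_trans sMG) // centsC subsetIr.
  have abMZ: abelian (M <*> 'Z(G)) by rewrite abelianY abM center_abelian.
  have sMZG: (M <*> 'Z(G))%G \subset G by rewrite join_subG sMG center_sub.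
  have [<- | eG] := maxP _ (joing_subl _ _) sMZG; first exact: joing_subr.
  have: #|G : 'Z(G)|%g == 1%N.
    by rewrite indexg_eq1 subsetI subxx; move: abMZ; rewrite /= -[(_ <*> _)%g]/(gval _) eG.
  by rewrite oGZ -(expn0 p) eqn_exp2l.
have iM : #|G : M|%g = p.
  have prI := maximal_nilpotent_prime_index nilG maxM.
  have: (#|G : M|%g %| p ^ 3)%N by rewrite -oGZ -(Lagrange_index sMG sZM) dvdn_mulr.
  by rewrite (Euclid_dvdX _ _ prI) dvdn_prime2 // => /andP[/eqP].
have iMZ : #|M : 'Z(G)|%g = (p ^ 2)%N.
  by apply/eqP; rewrite -(eqn_pmul2l p0) -{1}iM Lagrange_index // oGZ -expnS.
split=> // x.
  case/setDP=> Mx nZx; have Gx := subsetP sMG x Mx.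
  have GZx: x \in G :\: 'Z(G)%g by rewrite inE nZx.
  have sMC: M \subset ('C_G[x])%G.
    by rewrite subsetI sMG sub_cent1 (subsetP abM).
  rewrite -index_cent1; have [-> // | eG] := maxP _ sMC (subsetIl _ _).
  by have := class_gt1 GZx; rewrite -index_cent1 eG indexgg.
case/setDP=> Gx nMx; have GZx: x \in G :\: 'Z(G)%g.
  by rewrite inE Gx (contra (subsetP sZM x)).
have [e [/andP[e0 e3] -> oC]] := noncentral_class p_pr oGZ GZx.
have sCMZ : ('C_G[x] :&: M)%g \subset 'Z(G)%g.
  apply/subsetP => u /setIP[/setIP[Gu cxu] Mu]; rewrite inE Gu.
  have sMC: M \subset ('C_G[u])%G.
    by rewrite subsetI sMG sub_cent1 (subsetP abM).
  have [eM | eG] := maxP _ sMC (subsetIl _ _).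
    by case/negP: nMx; rewrite -eM inE Gx cent1C.
  by rewrite -sub_cent1 -{1}eG subsetIr.
have : e != 1%N.
  apply/eqP => e1; subst e.
  have: (#|'C_G[x]%g| * #|M| <= #|G| * #|'Z(G)%g|)%N.
    rewrite mul_cardG leq_mul ?subset_leq_card //.
    by rewrite mul_subG ?subsetIl.
  rewrite -(Lagrange (center_sub_cent1 Gx)) -(Lagrange sZM) -(Lagrange (center_sub G)).
  rewrite oC iMZ oGZ mulnACA [leqRHS]mulnAC leq_pmul2l ?muln_gt0 ?cardG_gt0 //.
  by rewrite -expnD leq_exp2l.
by move: e0 e3; case: e {oC} => [|[|[|]]].
Qed.

(** Subgroups inside M contribute the first three values, of index 1, p and p^2
    over Z; subgroups outside M of index p, p^2 and p^3 over Z contribute the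
    last three, the value (q^2 + q - 1)/q^3 being common to both kinds. *)
Lemma abelian_maximal_degs p (M : {group gT}) : nilpotent G -> prime p ->
    #|G : 'Z(G)|%g = (p ^ 3)%N -> maximal M G -> abelian M ->
  let q : rat := p%:R in
  D = [fset v in [:: 1; (2 * q - 1) / q ^+ 2; (q ^+ 2 + q - 1) / q ^+ 3;
                (3 * q - 2) / q ^+ 3; (2 * q ^+ 2 - 1) / q ^+ 4]]%fset.
Proof.
move=> nilG p_pr oGZ maxM abM q.
have [sZM iMZ iM cM cGM] := abelian_maximal_classes nilG p_pr oGZ maxM abM.
have p1 := prime_gt1 p_pr; have p0 := prime_gt0 p_pr.
have sMG := proper_sub (maxgroupp maxM).
have q0 : q != 0 by rewrite pnatr_eq0 -lt0n.
have in_M (H : {group gT}) : 'Z(G)%g \subset H -> H \subset M ->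
    d H = uniform_deg p #|H : 'Z(G)|%g.
  move=> sZH sHM; apply: deg_uniform => // h /setDP[Hh nZh].
  by apply: cM; rewrite inE nZh (subsetP sHM).
have out_M (H : {group gT}) a : 'Z(G)%g \subset H -> H \subset G ->
    ~~ (H \subset M) -> #|H : 'Z(G)|%g = (p * a)%N ->
    d H = (1 + (a%:R - 1) / q + (q * a%:R - a%:R) / q ^+ 2) / (q * a%:R).
  move=> sZH sHG nsHM oHZ.
  (* M is normal and H is not inside M, so H * M = G. *)
  have iHM : #|H : (H :&: M)|%g = p.
    rewrite indexgI -iM; apply/eqP; rewrite -(eqn_pmul2l (cardG_gt0 M)).
    rewrite LagrangeMl Lagrange //.
    have [_ nMG] := andP (maximal_nilpotent_normal nilG maxM).
    have nMH := subset_trans sHG nMG.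
    have : (M <*> H)%G = G.
      apply/eqP; apply: contraR nsHM => neG.
      case/maxgroupP: maxM => _ /(_ (M <*> H)%G) <-; rewrite ?joing_subl ?joing_subr //.
      rewrite properEneq join_subG sMG sHG !andbT; exact: neG.
    by move/(congr1 val) => /= <-; rewrite norm_joinEr.
  have sZN: 'Z(G)%g \subset H :&: M by rewrite subsetI sZH.
  have iNZ: #|H :&: M : 'Z(G)|%g = a.
    apply/eqP; rewrite -(eqn_pmul2l p0) -oHZ -{1}iHM.
    by rewrite (Lagrange_index (subsetIl _ _) sZN).
  rewrite (deg_layers (N := (H :&: M)%G) (c1 := p) (c2 := p ^ 2) sZN) ?subsetIl //=.
  - by rewrite iNZ oHZ natrM natrX.
  - move=> h /setDP[/setIP[_ Mh] nZh]; apply: cM; rewrite inE nZh //.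
  move=> h; rewrite setDIr setDv set0U => /setDP[Hh nMh].
  by apply: cGM; rewrite inE nMh (subsetP sHG).
have U0 : uniform_deg p (p ^ 0) = 1 by rewrite uniform_deg1.
have U1 : uniform_deg p (p ^ 1) = (2 * q - 1) / q ^+ 2.
  by rewrite uniform_degE ?expn_gt0 ?p0 // expn1 natrM -/q; field.
have U2 : uniform_deg p (p ^ 2) = (q ^+ 2 + q - 1) / q ^+ 3.
  by rewrite uniform_degE ?expn_gt0 ?p0 // natrM natrX -/q; field.
apply/fsetP => v; rewrite in_fset /= !in_cons in_nil orbF.
apply/rel_comm_degs_centerP/idP => [[H [sZH sHG ->]] | ].
  have [sHM | nsHM] := boolP (H \subset M).
    rewrite in_M //.
    have: (#|H : 'Z(G)|%g %| p ^ 2)%N by rewrite -iMZ -(Lagrange_index sHM sZH) dvdn_mull.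
    case/(dvdn_pfactor _ _ p_pr) => -[|[|[|//]]] _ ->; rewrite ?U0 ?U1 ?U2 eqxx ?orbT //.
  have: (#|H : 'Z(G)|%g %| p ^ 3)%N by rewrite -oGZ -(Lagrange_index sHG sZH) dvdn_mull.
  case/(dvdn_pfactor _ _ p_pr) => -[_ | k le3] oH.
    by case/negP: nsHM; move/eqP: oH; rewrite indexg_eq1 => /subset_trans->.
  rewrite (out_M _ (p ^ k)%N) -?expnS // natrX -/q.
  case: k le3 {oH} => [|[|[|//]]] _.
  - rewrite (_ : _ / _ = (q ^+ 2 + q - 1) / q ^+ 3) ?eqxx ?orbT //.
    by field.
  - rewrite (_ : _ / _ = (3 * q - 2) / q ^+ 3) ?eqxx ?orbT //.
    by field.
  rewrite (_ : _ / _ = (2 * q ^+ 2 - 1) / q ^+ 4) ?eqxx ?orbT //.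
  by field.
case/or4P=> [/eqP-> | /eqP-> | /eqP-> | /orP[] /eqP->].
- by exists 'Z(G)%G; rewrite center_sub rel_comm_deg_center.
- have /subsetPn[x Mx nZx]: ~~ (M \subset 'Z(G)%g).
    by rewrite -indexg_eq1 iMZ -(expn0 p) eqn_exp2l.
  have GZx: x \in G :\: 'Z(G)%g by rewrite inE nZx (subsetP sMG).
  have [y xy oy] := prime_order_mod_center p_pr oGZ GZx.
  have My: y \in M by apply: (subsetP _ y xy); rewrite cycle_subG.
  have Gy := subsetP sMG y My.
  have [_ nZy]: y \in G /\ y \notin 'Z(G)%g.
    by apply/setDP; apply: prime_coset_noncentral; rewrite ?oy.
  exists (cycZ G y); rewrite joing_subr cycZ_sub // deg_prime_cycZ ?oy //.
  by rewrite (cM y) -?U1 ?expn1 // inE nZy.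
- by exists M; rewrite sZM sMG in_M // iMZ U2.
(* A maximal subgroup of G through an element outside M has index p^2 over Z
   and is not inside M. *)
- have [_ [x Gx nMx]] := properP (maxgroupp maxM).
  (* The subgroup <x>Z is proper, as G / Z is not cyclic. *)
  have [eG | [H maxH sXH]] := maximal_exists (cycZ_sub Gx).
    case/negP: nMx; apply: (subsetP sZM).
    have cycG : cyclic (G / 'Z(G))%g.
      by have := cycle_cyclic (coset 'Z(G) x); rewrite -(coset_center_cycle Gx) eG.
    by rewrite (center_idP (cyclic_center_factor_abelian cycG)).
  have sHG := proper_sub (maxgroupp maxH).
  have sZH: 'Z(G)%g \subset H by apply: subset_trans sXH; apply: joing_subr.
  have nsHM: ~~ (H \subset M).
    apply: contra nMx => /subsetP; apply; apply: (subsetP sXH).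
    by rewrite mem_gen // inE cycle_id.
  have iH : #|G : H|%g = p.
    have prI := maximal_nilpotent_prime_index nilG maxH.
    have: (#|G : H|%g %| p ^ 3)%N by rewrite -oGZ -(Lagrange_index sHG sZH) dvdn_mulr.
    by rewrite (Euclid_dvdX _ _ prI) dvdn_prime2 // => /andP[/eqP].
  have iHZ : #|H : 'Z(G)|%g = (p * p)%N.
    by apply/eqP; rewrite -(eqn_pmul2l p0) -{1}iH Lagrange_index // oGZ !expnS muln1.
  by exists H; split=> //; rewrite (out_M _ p) // -/q; field.
exists G; split=> //; first exact: center_sub.
have iG: #|G : 'Z(G)|%g = (p * p ^ 2)%N by rewrite oGZ expnS.
rewrite (out_M _ (p ^ 2)%N) ?center_sub //.
  by rewrite natrX -/q; field.
by case/andP: (maxgroupp maxM).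
Qed.

(** The list is strictly decreasing: consecutive differences all have the form
    (q - 1)^2 / q^k. *)
Lemma abelian_maximal_degs_uniq (q : rat) : 1 < q ->
  uniq [:: 1; (2 * q - 1) / q ^+ 2; (q ^+ 2 + q - 1) / q ^+ 3;
                (3 * q - 2) / q ^+ 3; (2 * q ^+ 2 - 1) / q ^+ 4].
Proof.
move=> q1; have q0 : 0 < q by apply: lt_trans q1.
have nq0 : q != 0 by rewrite gt_eqF.
have gap k : 0 < (q - 1) ^+ 2 / q ^+ k.
  by rewrite divr_gt0 ?exprn_gt0 // subr_gt0.
apply: (@sorted_uniq _ >%R) => [x y z /= xy yz | x /= | ].
- exact: lt_trans yz xy.
- exact: ltxx.
rewrite /= andbT; apply/and4P; split; rewrite -subr_gt0.
- by rewrite (_ : _ - _ = (q - 1) ^+ 2 / q ^+ 2) //; field.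
- by rewrite (_ : _ - _ = (q - 1) ^+ 2 / q ^+ 3) //; field.
- by rewrite (_ : _ - _ = (q - 1) ^+ 2 / q ^+ 3) //; field.
by rewrite (_ : _ - _ = (q - 1) ^+ 2 / q ^+ 4) //; field.
Qed.

End FiveDegrees.

Lemma fset5E (T : choiceType) (a b c d e : T) :
  [fset a; b; c; d; e]%fset = [fset x in [:: a; b; c; d; e]]%fset.
Proof.
by apply/fsetP => x; rewrite !inE orbF -!orbA.
Qed.

Theorem theorem1p5 (gT : finGroupType) (G : {group gT}) (nilG : nilpotent G) :
  [/\ #|` rel_comm_degs G| = 5%N <->
        (exists p : nat,
           prime p /\ (abelian_max_quo_p3 G p \/ exists m : nat, two_class_sizes_quo_p4 G p m)),
      forall p : nat, prime p -> abelian_max_quo_p3 G p ->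
        let q : rat := p%:R in
        rel_comm_degs G =
          [fset 1; (2 * q - 1) / q ^+ 2; (q ^+ 2 + q - 1) / q ^+ 3;
                (3 * q - 2) / q ^+ 3; (2 * q ^+ 2 - 1) / q ^+ 4]%fset
    & forall p m : nat, prime p -> two_class_sizes_quo_p4 G p m ->
        let q : rat := p%:R in
        rel_comm_degs G =
          [fset 1; (q ^+ m + q - 1) / q ^+ (m + 1);
                (q ^+ m + q ^+ 2 - 1) / q ^+ (m + 2);
                (q ^+ m + q ^+ 3 - 1) / q ^+ (m + 3);
                (q ^+ m + q ^+ 4 - 1) / q ^+ (m + 4)]%fset].
Proof.
have oQ : #|G / 'Z(G)|%g = #|G : 'Z(G)|%g by rewrite card_quotient ?normal_norm ?center_normal.
have nab p k : prime p -> #|G : 'Z(G)|%g = (p ^ k.+1)%N -> ~~ abelian G.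
  move=> p_pr oGZ; apply/negP => /center_idP eG.
  by move: oGZ; rewrite eG indexgg => /esym/eqP; rewrite -(expn0 p) eqn_exp2l ?prime_gt1.
split; first split.
- move=> D5; have [p [n [p_pr oGZ n4]]] := five_degs_center_index nilG D5.
  exists p; split=> //; have [n3 | n3] := leqP n 3.
    have [en exM] := five_degs_index_le3 D5 p_pr oGZ n3; subst n.
    by left; split; rewrite ?oQ.
  have en : n = 4%N by apply/eqP; rewrite eqn_leq n4.
  subst n; have [m /andP[m0 m4] cm] := five_degs_uniform nilG D5 p_pr oGZ.
  right; exists m; split; first by rewrite oQ.
    by case: m m0 m4 {cm} => [|[|[|[|m]]]].
  exact/(class_sizes_uniformP _ (nab _ _ p_pr oGZ)).
- case=> p [p_pr []].
    case; rewrite oQ => oGZ [M [maxM abM]].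
    rewrite (abelian_maximal_degs nilG p_pr oGZ maxM abM) card_fseq undup_id //.
    by apply: abelian_maximal_degs_uniq; rewrite ltr1n prime_gt1.
  case=> m; case; rewrite oQ => oGZ m3 /(class_sizes_uniformP _ (nab _ _ p_pr oGZ)) cm.
  apply: (card_degs_uniform p_pr oGZ cm).
  by rewrite -(expn0 p) ltn_exp2l ?prime_gt1 //; case: m m3 {cm}.
- move=> p p_pr [+ [M [maxM abM]]] q; rewrite oQ => oGZ.
  by rewrite fset5E (abelian_maximal_degs nilG p_pr oGZ maxM abM).
move=> p m p_pr []; rewrite oQ => oGZ _ /(class_sizes_uniformP _ (nab _ _ p_pr oGZ)) cm q.
rewrite fset5E (rel_comm_degs_uniform p_pr oGZ cm) /= uniform_deg1.
by rewrite !uniform_degE ?expn_gt0 ?prime_gt0 // -!expnD !natrX -/q expr1.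
Qed.
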